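(* Let $\mathcal{M}^{II}_m$ be a timelike second kind meridian surface of hyperbolic type in $\mathbb{R}^4_1$, parametrized by $z(u,v)=f(u)\,l(v)+g(u)\,e_1$, $u\in I$, $v\in J$. Then $\mathcal{M}^{II}_m$ has constant non-zero Gauss curvature $K$ if and only if the meridian curve $m:u\mapsto(f(u),g(u))$ is given by $$f(u)=a_1\cos(\sqrt{-K}\,u)+a_2\sin(\sqrt{-K}\,u)\quad\text{if }K<0,$$ $$f(u)=a_1\cosh(\sqrt{K}\,u)+a_2\sinh(\sqrt{K}\,u)\quad\text{if }K>0,$$ where $a_1,a_2$ are constants and the function $g(u)$ is determined by $\dot g(u)=\pm\sqrt{\dot f^2(u)-1}$.
   Context: $\mathbb{R}^4_1$ is the Minkowski 4-space with metric $\langle\cdot,\cdot\rangle = dx_1^2+dx_2^2+dx_3^2-dx_4^2$ and standard orthonormal frame $e_1,e_2,e_3,e_4$ ($e_4$ timelike). $\mathbb{H}^2(-1)=\{V\in\mathrm{span}\{e_2,e_3,e_4\}:\langle V,V\rangle=-1,\ \text{the } e_4\text{-coordinate of }V\text{ is positive}\}$. A timelike second kind meridian surface of hyperbolic type is the surface $z(u,v)=f(u)l(v)+g(u)e_1$, where $I,J\subset\mathbb{R}$ are intervals, $f,g:I\to\mathbb{R}$ are smooth with $f>0$, and $l:J\to\mathbb{H}^2(-1)$ is a smooth curve with $\langle l',l'\rangle=1$ (prime $=d/dv$). The meridian curve is normalized by $\dot f^2-\dot g^2=1$ (dot $=d/du$), so the induced metric is $-du^2+f(u)^2dv^2$, which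 is Lorentzian. The Gauss curvature is that of this metric, $K=\dfrac{\langle\sigma(X,X),\sigma(Y,Y)\rangle-\langle\sigma(X,Y),\sigma(X,Y)\rangle}{\langle X,X\rangle\langle Y,Y\rangle-\langle X,Y\rangle^2}$, with $\sigma$ the second fundamental form. *)

(* Defs.v *)
From Stdlib Require Import Reals Lra.
From Coquelicot Require Import Coquelicot.
Open Scope R_scope.

(** * Minkowski 4-space *)

(** The vector space structure ([plus], [minus], [scal], ...) is Coquelicot's
    structure on products. *)
Notation R41 := (R * R * R * R)%type.

Definition x1 (V : R41) : R := fst (fst (fst V)).
Definition x2 (V : R41) : R := snd (fst (fst V)).
Definition x3 (V : R41) : R := snd (fst V).
Definition x4 (V : R41) : R := snd V.

Definition e1 : R41 := (1, 0, 0, 0).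

Definition mink (V W : R41) : R :=
  x1 V * x1 W + x2 V * x2 W + x3 V * x3 W - x4 V * x4 W.

(** [H2 V]: the vector [V] lies in the upper sheet of the unit hyperboloid of
    span(e2, e3, e4). *)
Definition H2 (V : R41) : Prop := x1 V = 0 /\ mink V V = -1 /\ 0 < x4 V.

Definition Dvec (c : R -> R41) (t : R) : R41 :=
  (Derive (fun s => x1 (c s)) t, Derive (fun s => x2 (c s)) t,
   Derive (fun s => x3 (c s)) t, Derive (fun s => x4 (c s)) t).

(** * Intervals and smoothness *)

(** Open, closed, half-open and unbounded intervals are all allowed; empty and
    one-point intervals are excluded. *)
Definition nondegenerate_interval (I : R -> Prop) : Prop :=
  (forall x y t, I x -> I y -> x <= t <= y -> I t) /\
  (exists x y, I x /\ I y /\ x < y).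

(** Functions on [I] are represented by total functions, so smoothness on [I]
    is smoothness on a neighbourhood of each point of [I].  Since [I] is
    nondegenerate, all derivatives at points of [I], endpoints included, depend
    only on the restriction to [I]. *)
Definition smooth_on (I : R -> Prop) (f : R -> R) : Prop :=
  forall x, I x -> locally x (fun y => forall n, ex_derive_n f n y).

Definition smooth_curve_on (J : R -> Prop) (c : R -> R41) : Prop :=
  smooth_on J (fun t => x1 (c t)) /\ smooth_on J (fun t => x2 (c t)) /\
  smooth_on J (fun t => x3 (c t)) /\ smooth_on J (fun t => x4 (c t)).

(** * Geometry of a parametrized surface [z : (u, v) |-> z u v] *)

Definition z_u (z : R -> R -> R41) (u v : R) : R41 := Dvec (fun s => z s v) u.
Definition z_v (z : R -> R -> R41) (u v : R) : R41 := Dvec (fun t => z u t) v.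
Definition z_uu (z : R -> R -> R41) (u v : R) : R41 := Dvec (fun s => z_u z s v) u.
Definition z_uv (z : R -> R -> R41) (u v : R) : R41 := Dvec (fun t => z_u z u t) v.
Definition z_vv (z : R -> R -> R41) (u v : R) : R41 :=
  Dvec (fun t => z_v z u t) v.

(** A tangent vector at [(u, v)] is given by its coordinates
    [X : R * R] in the frame [z_u, z_v]. *)
Definition tangent (z : R -> R -> R41) (u v : R) (X : R * R) : R41 :=
  plus (scal (fst X) (z_u z u v)) (scal (snd X) (z_v z u v)).

Definition metric (z : R -> R -> R41) (u v : R) (X Y : R * R) : R :=
  mink (tangent z u v X) (tangent z u v Y).

(** Orthogonal projections of an ambient vector [W]; they are meaningful where
    the induced metric is nondegenerate. The coordinates of the tangential part
    solve the 2x2 Gram system. *)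
Definition tangential_part (z : R -> R -> R41) (u v : R) (W : R41) : R41 :=
  let E := mink (z_u z u v) (z_u z u v) in
  let F := mink (z_u z u v) (z_v z u v) in
  let G := mink (z_v z u v) (z_v z u v) in
  let p := mink W (z_u z u v) in
  let q := mink W (z_v z u v) in
  tangent z u v ((G * p - F * q) / (E * G - F ^ 2),
                 (E * q - F * p) / (E * G - F ^ 2)).

Definition normal_part (z : R -> R -> R41) (u v : R) (W : R41) : R41 :=
  minus W (tangential_part z u v W).

(** The second fundamental form: the normal part of the ambient (flat)
    derivative; for vector fields with constant coordinates [X] and [Y] that
    derivative is the sum of the [X^i Y^j z_ij]. *)
Definition sigma (z : R -> R -> R41) (u v : R) (X Y : R * R) : R41 :=
  normal_part z u v
    (plus (scal (fst X * fst Y) (z_uu z u v))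
       (plus (scal (fst X * snd Y + snd X * fst Y) (z_uv z u v))
             (scal (snd X * snd Y) (z_vv z u v)))).

Definition gauss_quotient (z : R -> R -> R41) (u v : R) (X Y : R * R) : R :=
  (mink (sigma z u v X X) (sigma z u v Y Y)
     - mink (sigma z u v X Y) (sigma z u v X Y))
  / (metric z u v X X * metric z u v Y Y - metric z u v X Y ^ 2).

Definition gauss_curvature (z : R -> R -> R41) (u v : R) : R :=
  gauss_quotient z u v (1, 0) (0, 1).

Lemma normal_part_orthogonal (z : R -> R -> R41) (u v : R) (W : R41)
    (X : R * R) :
  mink (z_u z u v) (z_u z u v) * mink (z_v z u v) (z_v z u v)
    - mink (z_u z u v) (z_v z u v) ^ 2 <> 0 ->
  mink (normal_part z u v W) (tangent z u v X) = 0.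
Proof.
unfold normal_part, tangential_part, tangent.
destruct (z_u z u v) as [[[a1 a2] a3] a4], (z_v z u v) as [[[b1 b2] b3] b4].
destruct W as [[[w1 w2] w3] w4], X as [p q].
cbv -[Rplus Rmult Rminus Ropp Rdiv Rinv pow IZR not].
intros H; field; exact H.
Qed.

Lemma gauss_quotient_frame (z : R -> R -> R41) (u v : R) (X Y : R * R) :
  mink (z_u z u v) (z_u z u v) * mink (z_v z u v) (z_v z u v)
    - mink (z_u z u v) (z_v z u v) ^ 2 <> 0 ->
  fst X * snd Y - snd X * fst Y <> 0 ->
  gauss_quotient z u v X Y = gauss_curvature z u v.
Proof.
intros HD Hd; unfold gauss_curvature, gauss_quotient.
set (A := normal_part z u v (z_uu z u v)).
set (B := normal_part z u v (z_uv z u v)).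
set (C := normal_part z u v (z_vv z u v)).
assert (Hs : forall P Q : R * R, sigma z u v P Q =
  plus (scal (fst P * fst Q) A)
    (plus (scal (fst P * snd Q + snd P * fst Q) B)
          (scal (snd P * snd Q) C))).
{ intros P Q; unfold A, B, C, sigma, normal_part, tangential_part, tangent.
  destruct (z_uu z u v) as [[[c1 c2] c3] c4], (z_uv z u v) as [[[d1 d2] d3] d4].
  destruct (z_vv z u v) as [[[h1 h2] h3] h4], P as [p1 p2], Q as [q1 q2].
  revert HD.
  destruct (z_u z u v) as [[[a1 a2] a3] a4], (z_v z u v) as [[[b1 b2] b3] b4].
  cbv -[Rplus Rmult Rminus Ropp Rdiv Rinv pow IZR not].
  intros HD.
  repeat match goal with |- (_, _) = (_, _) => apply f_equal2 end;
    field; exact HD. }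
rewrite !Hs; clear Hs; unfold metric, tangent.
revert HD; clearbody A B C.
destruct (z_u z u v) as [[[a1 a2] a3] a4], (z_v z u v) as [[[b1 b2] b3] b4].
destruct A as [[[c1 c2] c3] c4], B as [[[d1 d2] d3] d4].
destruct C as [[[h1 h2] h3] h4], X as [p1 p2], Y as [q1 q2].
revert Hd; cbv -[Rplus Rmult Rminus Ropp Rdiv Rinv pow IZR not]; intros Hd HD.
match type of HD with ?D <> 0 =>
match type of Hd with ?d <> 0 =>
match goal with |- ?n / ?m = ?n' / ?m' =>
  replace n with (d ^ 2 * n') by ring;
  replace m with (d ^ 2 * D) by ring;
  replace m' with D by ring;
  generalize n' end;
generalize dependent D; generalize dependent d end end.
intros d Hd D HD n; field; split; assumption.
Qed.

(** * Timelike second kind meridian surfaces of hyperbolic type *)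

Definition meridian_surface (f g : R -> R) (l : R -> R41) (u v : R) : R41 :=
  plus (scal (f u) (l v)) (scal (g u) e1).

Record timelike_meridian_II_hyperbolic
    (I J : R -> Prop) (f g : R -> R) (l : R -> R41) : Prop := {
  tm_I : nondegenerate_interval I;
  tm_J : nondegenerate_interval J;
  tm_f_smooth : smooth_on I f;
  tm_g_smooth : smooth_on I g;
  tm_l_smooth : smooth_curve_on J l;
  tm_f_pos : forall u, I u -> 0 < f u;
  tm_l_H2 : forall v, J v -> H2 (l v);
  tm_l_unit : forall v, J v -> mink (Dvec l v) (Dvec l v) = 1;
  tm_normalized : forall u, I u -> (Derive f u) ^ 2 - (Derive g u) ^ 2 = 1
}.

(* Main.v *)
Require Import Defs.
From Stdlib Require Import Reals Lra Ranalysis5.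
From Coquelicot Require Import Coquelicot.
Open Scope R_scope.

(** The induced metric is [-du^2 + f^2 dv^2], and the curvature of such a
    surface depends on [f] alone: it is [f'' / f] ([gauss_curvature_meridian]).
    To see this from the second fundamental form, observe that [l], [l'], [e1]
    are orthonormal up to sign, that differentiating [<l,l> = -1] twice gives
    [<l,l''> = - <l',l'> = -1], and that differentiating [f'^2 - g'^2 = 1] gives
    [f' f'' = g' g''].  Hence [z_uu] is already normal, [z_uv = f' l'] is
    tangent, and the numerator of the Gauss quotient is
    [<z_uu, z_vv> = f f'' <l,l''> = - f f''], over the denominator [- f^2].

    So constant curvature [K] is the linear equation [f'' = K f], whose
    solutions are combinations of [cos], [sin] or of [cosh], [sinh]; the two
    cases are one computation ([oscillator_solutions]).

    It remains to see that the sign in [g' = +- sqrt (f'^2 - 1)] is the same on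
    the whole interval.  If [g'] vanished at some point, then [f'^2 = 1] and
    [f' f'' = g' g'' = 0] there, so [K f = f'' = 0], against [f > 0] and
    [K <> 0].  Thus [g'] has no zero, and being continuous it has a constant
    sign ([continuous_sign_on_interval]).

    The intervals may contain their endpoints, while the identities between
    [f], [g], [l] hold on the intervals only; that they can nevertheless be
    differentiated at endpoints is [is_derive_eq_on_interval]. *)

(** * Calculus on intervals *)

(** [auto_derive] leaves eta-expanded functions under [Derive], which rewriting
    and [ring] do not identify with the functions themselves. *)
Ltac eta_derive :=
  repeat match goal with |- context [Derive (fun x => ?h x) ?t] =>
    progress change (Derive (fun x => h x) t) with (Derive h t) end.

(** Difference quotients may be taken inside the interval, even at an
    endpoint. *)
Lemma is_derive_eq_on_interval (I : R -> Prop) (h1 h2 : R -> R) (x d1 d2 : R) :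
  nondegenerate_interval I -> I x -> (forall y, I y -> h1 y = h2 y) ->
  is_derive h1 x d1 -> is_derive h2 x d2 -> d1 = d2.
Proof.
intros [Hconv [p [q [Hp [Hq Hpq]]]]] Hx Heq D1 D2.
assert (D : is_derive (fun y => minus (h1 y) (h2 y)) x (minus d1 d2))
  by (now apply (is_derive_minus h1 h2)).
apply is_derive_Reals in D.
destruct (Req_dec (d1 - d2) 0) as [E|E]; [lra|exfalso].
destruct (D (Rabs (d1 - d2))) as [[del Hdel] Hlim]; [now apply Rabs_pos_lt|].
simpl in Hlim.
assert (Hstep : exists t, t <> 0 /\ Rabs t < del /\ I (x + t)).
{ destruct (Rlt_dec x q) as [Hxq|Hxq].
  - exists (Rmin (del / 2) (q - x)).
    assert (0 < Rmin (del / 2) (q - x)) by (apply Rmin_pos; lra).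
    pose proof (Rmin_l (del / 2) (q - x)).
    pose proof (Rmin_r (del / 2) (q - x)).
    rewrite Rabs_pos_eq by lra.
    repeat split; try lra.
    apply (Hconv x q); auto; lra.
  - exists (- Rmin (del / 2) (x - p)).
    assert (0 < Rmin (del / 2) (x - p)) by (apply Rmin_pos; lra).
    pose proof (Rmin_l (del / 2) (x - p)).
    pose proof (Rmin_r (del / 2) (x - p)).
    rewrite Rabs_Ropp, Rabs_pos_eq by lra.
    repeat split; try lra.
    apply (Hconv p x); auto; lra. }
destruct Hstep as [t [Ht0 [Htd HIt]]].
specialize (Hlim t Ht0 Htd).
change (Rabs ((h1 (x + t) - h2 (x + t) - (h1 x - h2 x)) / t - (d1 - d2))
        < Rabs (d1 - d2)) in Hlim.
rewrite (Heq _ HIt), (Heq _ Hx) in Hlim.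
replace ((h2 (x + t) - h2 (x + t) - (h2 x - h2 x)) / t - (d1 - d2))
  with (- (d1 - d2)) in Hlim by (field; exact Ht0).
rewrite Rabs_Ropp in Hlim; lra.
Qed.

Lemma is_derive_const_on_interval (I : R -> Prop) (h : R -> R) (a x d : R) :
  nondegenerate_interval I -> I x -> (forall y, I y -> h y = a) ->
  is_derive h x d -> d = 0.
Proof.
intros HI Hx Hh D.
apply (is_derive_eq_on_interval I h (fun _ => a) x); auto.
exact (is_derive_const a x).
Qed.

Lemma smooth_on_is_derive (I : R -> Prop) (f : R -> R) (x : R) :
  smooth_on I f -> I x -> is_derive f x (Derive f x).
Proof.
intros Hf Hx; apply Derive_correct.
exact (locally_singleton _ _ (Hf x Hx) 1%nat).
Qed.

Lemma smooth_on_is_derive_near (I : R -> Prop) (f : R -> R) (x : R) :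
  smooth_on I f -> I x -> locally x (fun y => is_derive f y (Derive f y)).
Proof.
intros Hf Hx; generalize (Hf x Hx); apply filter_imp.
intros y Hy; apply Derive_correct; exact (Hy 1%nat).
Qed.

Lemma smooth_on_is_derive2 (I : R -> Prop) (f : R -> R) (x : R) :
  smooth_on I f -> I x -> is_derive (Derive f) x (Derive (Derive f) x).
Proof.
intros Hf Hx; apply Derive_correct.
exact (locally_singleton _ _ (Hf x Hx) 2%nat).
Qed.

Lemma derive_zero_const_on_interval (I : R -> Prop) (h : R -> R) :
  nondegenerate_interval I -> (forall x, I x -> is_derive h x 0) ->
  forall x y, I x -> I y -> h x = h y.
Proof.
intros [Hconv _] Hh.
assert (Hlt : forall x y, I x -> I y -> x < y -> h x = h y).
{ intros x y Hx Hy Hxy; apply (eq_is_derive h x y); [|exact Hxy].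
  intros t Ht; apply Hh; apply (Hconv x y); assumption. }
intros x y Hx Hy; destruct (Rtotal_order x y) as [L|[->|L]]; auto.
symmetry; auto.
Qed.

(** The values at any two points have a positive product, by the intermediate
    value theorem, so the sign can be read at a single point. *)
Lemma continuous_sign_on_interval (I : R -> Prop) (h : R -> R) :
  nondegenerate_interval I -> (forall x, I x -> continuous h x) ->
  (forall x, I x -> h x <> 0) ->
  exists eps, (eps = 1 \/ eps = -1) /\ forall x, I x -> h x = eps * Rabs (h x).
Proof.
intros [Hconv [p [_ [Hp _]]]] Hc Hnz.
assert (Hlt : forall x y, I x -> I y -> x < y -> 0 < h x * h y).
{ intros x y Hx Hy Hxy.
  destruct (Rlt_dec 0 (h x * h y)) as [Hpos|Hneg]; [exact Hpos|exfalso].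
  pose proof (Hnz x Hx) as Nx; pose proof (Hnz y Hy) as Ny.
  (* Scaling by [h y] makes the values at [x] and [y] negative and positive,
     whichever sign [h y] has. *)
  destruct (IVT_interv (mult_real_fct (h y) h) x y) as [t [Ht H0]].
  - intros t Ht; apply continuity_pt_scal, continuity_pt_filterlim, Hc.
    now apply (Hconv x y).
  - exact Hxy.
  - pose proof (Rmult_integral_contrapositive _ _ (conj Nx Ny)).
    unfold mult_real_fct; lra.
  - unfold mult_real_fct; nra.
  - destruct (Rmult_integral _ _ H0) as [E|E]; [now apply Ny|].
    apply (Hnz t); [now apply (Hconv x y)|exact E]. }
assert (Hsame : forall x, I x -> 0 < h p * h x).
{ intros x Hx; destruct (Rtotal_order p x) as [L|[<-|L]]; auto.
  - pose proof (Hnz p Hp); nra.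
  - rewrite Rmult_comm; auto. }
destruct (Rlt_dec 0 (h p)) as [Hs|Hs].
- exists 1; split; [now left|]; intros x Hx; specialize (Hsame x Hx).
  rewrite Rabs_pos_eq; nra.
- exists (-1); split; [now right|]; intros x Hx; specialize (Hsame x Hx).
  pose proof (Hnz p Hp); rewrite Rabs_left; nra.
Qed.

(** * The equation f'' = K f *)

(** With [e = -1] for [cos], [sin] and [e = 1] for [cosh], [sinh], the pair
    [c], [s] is a rotation or a boost of parameter [k x].  Applying the inverse
    rotation to [(f, f' / k)] gives the coefficients [a1], [a2], which are
    constant exactly because of the equation. *)
Lemma oscillator_solutions (I : R -> Prop) (f c s : R -> R) (e k K : R) :
  nondegenerate_interval I -> smooth_on I f -> k <> 0 -> K = e * k ^ 2 ->
  (forall x, is_derive c x (e * k * s x)) ->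
  (forall x, is_derive s x (k * c x)) ->
  (forall x, c x ^ 2 - e * s x ^ 2 = 1) ->
  (forall u, I u -> Derive (Derive f) u = K * f u) <->
  exists a1 a2, forall u, I u -> f u = a1 * c u + a2 * s u.
Proof.
intros HI Hf Hk -> Hc Hs Hcs; split.
- intros Hode.
  set (A := fun u => f u * c u - Derive f u * s u / k).
  set (B := fun u => Derive f u * c u / k - e * (f u * s u)).
  assert (HA : forall u, I u -> is_derive A u 0).
  { intros u Hu; unfold A.
    pose proof (smooth_on_is_derive I f u Hf Hu) as F1.
    pose proof (smooth_on_is_derive2 I f u Hf Hu) as F2.
    auto_derive.
    - repeat split; eexists; eauto.
    - eta_derive.
      rewrite (is_derive_unique _ _ _ (Hc u)), (is_derive_unique _ _ _ (Hs u)).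
      rewrite (Hode u Hu); field; exact Hk. }
  assert (HB : forall u, I u -> is_derive B u 0).
  { intros u Hu; unfold B.
    pose proof (smooth_on_is_derive I f u Hf Hu) as F1.
    pose proof (smooth_on_is_derive2 I f u Hf Hu) as F2.
    auto_derive.
    - repeat split; eexists; eauto.
    - eta_derive.
      rewrite (is_derive_unique _ _ _ (Hc u)), (is_derive_unique _ _ _ (Hs u)).
      rewrite (Hode u Hu); field; exact Hk. }
  pose proof HI as [_ [p [_ [Hp _]]]].
  exists (A p), (B p); intros u Hu.
  rewrite (derive_zero_const_on_interval I A HI HA p u Hp Hu).
  rewrite (derive_zero_const_on_interval I B HI HB p u Hp Hu).
  unfold A, B.
  transitivity (f u * (c u ^ 2 - e * s u ^ 2)).
  + rewrite Hcs; ring.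
  + field; exact Hk.
- intros [a1 [a2 Hsol]].
  assert (H1 : forall u, I u ->
            Derive f u = a1 * (e * k * s u) + a2 * (k * c u)).
  { intros u Hu.
    apply (is_derive_eq_on_interval I f (fun x => a1 * c x + a2 * s x) u); auto.
    - now apply (smooth_on_is_derive I).
    - apply @is_derive_plus; apply is_derive_scal; auto. }
  intros u Hu.
  transitivity (a1 * (e * k * (k * c u)) + a2 * (k * (e * k * s u))).
  + apply (is_derive_eq_on_interval I (Derive f)
             (fun x => a1 * (e * k * s x) + a2 * (k * c x)) u); auto.
    * now apply (smooth_on_is_derive2 I).
    * apply @is_derive_plus; do 2 apply is_derive_scal; auto.
  + rewrite (Hsol u Hu); ring.
Qed.

Lemma trigonometric_solutions (I : R -> Prop) (f : R -> R) (K : R) :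
  nondegenerate_interval I -> smooth_on I f -> K < 0 ->
  (forall u, I u -> Derive (Derive f) u = K * f u) <->
  exists a1 a2, forall u, I u ->
    f u = a1 * cos (sqrt (- K) * u) + a2 * sin (sqrt (- K) * u).
Proof.
intros HI Hf HK.
assert (Hk : sqrt (- K) <> 0) by (pose proof (sqrt_lt_R0 (- K)); lra).
assert (HK2 : K = -1 * sqrt (- K) ^ 2) by (rewrite pow2_sqrt; lra).
apply (oscillator_solutions I f (fun u => cos (sqrt (- K) * u))
         (fun u => sin (sqrt (- K) * u)) (-1) (sqrt (- K))); auto.
- intros x; auto_derive; [exact Logic.I|ring].
- intros x; auto_derive; [exact Logic.I|ring].
- intros x; pose proof (sin2_cos2 (sqrt (- K) * x)); unfold Rsqr in *; lra.
Qed.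

Lemma hyperbolic_solutions (I : R -> Prop) (f : R -> R) (K : R) :
  nondegenerate_interval I -> smooth_on I f -> 0 < K ->
  (forall u, I u -> Derive (Derive f) u = K * f u) <->
  exists a1 a2, forall u, I u ->
    f u = a1 * cosh (sqrt K * u) + a2 * sinh (sqrt K * u).
Proof.
intros HI Hf HK.
assert (Hk : sqrt K <> 0) by (pose proof (sqrt_lt_R0 K); lra).
assert (HK2 : K = 1 * sqrt K ^ 2) by (rewrite pow2_sqrt; lra).
apply (oscillator_solutions I f (fun u => cosh (sqrt K * u))
         (fun u => sinh (sqrt K * u)) 1 (sqrt K)); auto.
- intros x; unfold cosh, sinh; auto_derive; [exact Logic.I|field].
- intros x; unfold cosh, sinh; auto_derive; [exact Logic.I|field].
- intros x; unfold cosh, sinh.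
  rewrite exp_Ropp; field; apply Rgt_not_eq, exp_pos.
Qed.

(** * Minkowski algebra and derivatives of curves *)

Lemma mink_sym (V W : R41) : mink V W = mink W V.
Proof. unfold mink; ring. Qed.

Lemma mink_plus_l (U V W : R41) : mink (plus U V) W = mink U W + mink V W.
Proof.
change (mink (plus U V) W) with
  ((x1 U + x1 V) * x1 W + (x2 U + x2 V) * x2 W + (x3 U + x3 V) * x3 W
   - (x4 U + x4 V) * x4 W).
unfold mink; ring.
Qed.

Lemma mink_scal_l (a : R) (V W : R41) : mink (scal a V) W = a * mink V W.
Proof.
change (mink (scal a V) W) with
  (a * x1 V * x1 W + a * x2 V * x2 W + a * x3 V * x3 W - a * x4 V * x4 W).
unfold mink; ring.
Qed.

Lemma mink_minus_l (U V W : R41) : mink (minus U V) W = mink U W - mink V W.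
Proof.
change (mink (minus U V) W) with
  ((x1 U + - x1 V) * x1 W + (x2 U + - x2 V) * x2 W + (x3 U + - x3 V) * x3 W
   - (x4 U + - x4 V) * x4 W).
unfold mink; ring.
Qed.

Lemma mink_plus_r (U V W : R41) : mink W (plus U V) = mink W U + mink W V.
Proof. now rewrite mink_sym, mink_plus_l, !(mink_sym W). Qed.

Lemma mink_scal_r (a : R) (V W : R41) : mink W (scal a V) = a * mink W V.
Proof. now rewrite mink_sym, mink_scal_l, (mink_sym W). Qed.

Lemma mink_minus_r (U V W : R41) : mink W (minus U V) = mink W U - mink W V.
Proof. now rewrite mink_sym, mink_minus_l, !(mink_sym W). Qed.

Ltac mink_expand :=
  repeat first [rewrite mink_plus_l | rewrite mink_plus_r | rewrite mink_scal_l
    | rewrite mink_scal_r | rewrite mink_minus_l | rewrite mink_minus_r].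

(** In an orthogonal tangent frame the tangential part of a vector is read off
    from its two products with the frame, so second fundamental forms can be
    paired knowing only products of the derivatives of [z]. *)
Lemma mink_normal_part (z : R -> R -> R41) (u v : R) (V W : R41) :
  mink (z_u z u v) (z_v z u v) = 0 ->
  mink (z_u z u v) (z_u z u v) <> 0 -> mink (z_v z u v) (z_v z u v) <> 0 ->
  mink (normal_part z u v V) (normal_part z u v W) =
  mink V W
  - mink V (z_u z u v) * mink W (z_u z u v) / mink (z_u z u v) (z_u z u v)
  - mink V (z_v z u v) * mink W (z_v z u v) / mink (z_v z u v) (z_v z u v).
Proof.
intros HF HE HG.
unfold normal_part, tangential_part, tangent; cbn [fst snd].
mink_expand.
rewrite (mink_sym (z_v z u v) (z_u z u v)), (mink_sym (z_u z u v) W),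
  (mink_sym (z_v z u v) W), HF.
field; split; assumption.
Qed.

Definition derivable_curve_at (c : R -> R41) (t : R) : Prop :=
  ex_derive (fun s => x1 (c s)) t /\ ex_derive (fun s => x2 (c s)) t /\
  ex_derive (fun s => x3 (c s)) t /\ ex_derive (fun s => x4 (c s)) t.

Lemma smooth_curve_derivable_near (J : R -> Prop) (l : R -> R41) (v : R) :
  smooth_curve_on J l -> J v -> locally v (derivable_curve_at l).
Proof.
intros [H1 [H2 [H3 H4]]] Hv.
generalize (filter_and _ _ (H1 v Hv) (filter_and _ _ (H2 v Hv)
  (filter_and _ _ (H3 v Hv) (H4 v Hv)))).
apply filter_imp; intros t [D1 [D2 [D3 D4]]].
exact (conj (D1 1%nat) (conj (D2 1%nat) (conj (D3 1%nat) (D4 1%nat)))).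
Qed.

Lemma smooth_curve_derivable (J : R -> Prop) (l : R -> R41) (v : R) :
  smooth_curve_on J l -> J v -> derivable_curve_at l v.
Proof.
intros Hl Hv.
exact (locally_singleton _ _ (smooth_curve_derivable_near J l v Hl Hv)).
Qed.

Lemma smooth_curve_derivable2 (J : R -> Prop) (l : R -> R41) (v : R) :
  smooth_curve_on J l -> J v -> derivable_curve_at (Dvec l) v.
Proof.
intros [H1 [H2 [H3 H4]]] Hv.
exact (conj (locally_singleton _ _ (H1 v Hv) 2%nat)
  (conj (locally_singleton _ _ (H2 v Hv) 2%nat)
  (conj (locally_singleton _ _ (H3 v Hv) 2%nat)
        (locally_singleton _ _ (H4 v Hv) 2%nat)))).
Qed.

Lemma Dvec_ext_loc (c d : R -> R41) (t : R) :
  locally t (fun s => c s = d s) -> Dvec c t = Dvec d t.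
Proof.
intros H; unfold Dvec.
repeat match goal with |- (_, _) = (_, _) => apply f_equal2 end;
  apply Derive_ext_loc; revert H; apply filter_imp; now intros s ->.
Qed.

Lemma Dvec_coefficients (a b : R -> R) (V W : R41) (t da db : R) :
  is_derive a t da -> is_derive b t db ->
  Dvec (fun s => plus (scal (a s) V) (scal (b s) W)) t =
  plus (scal da V) (scal db W).
Proof.
intros Ha Hb.
assert (H : forall x y,
  Derive (fun s => a s * x + b s * y) t = da * x + db * y).
{ intros x y; apply is_derive_unique.
  auto_derive; [split; [|split]; try exact Logic.I; eexists; eauto|].
  eta_derive.
  rewrite (is_derive_unique _ _ _ Ha), (is_derive_unique _ _ _ Hb); ring. }
change (Dvec (fun s => plus (scal (a s) V) (scal (b s) W)) t) with
  (Derive (fun s => a s * x1 V + b s * x1 W) t,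
   Derive (fun s => a s * x2 V + b s * x2 W) t,
   Derive (fun s => a s * x3 V + b s * x3 W) t,
   Derive (fun s => a s * x4 V + b s * x4 W) t).
now rewrite !H.
Qed.

Lemma Dvec_affine (c : R -> R41) (a : R) (W : R41) (t : R) :
  derivable_curve_at c t ->
  Dvec (fun s => plus (scal a (c s)) W) t = scal a (Dvec c t).
Proof.
intros [D1 [D2 [D3 D4]]].
assert (H : forall h y, ex_derive h t ->
  Derive (fun s => a * h s + y) t = a * Derive h t).
{ intros h y Hh; apply is_derive_unique; auto_derive; auto; eta_derive; ring. }
change (Dvec (fun s => plus (scal a (c s)) W) t) with
  (Derive (fun s => a * x1 (c s) + x1 W) t,
   Derive (fun s => a * x2 (c s) + x2 W) t,
   Derive (fun s => a * x3 (c s) + x3 W) t,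
   Derive (fun s => a * x4 (c s) + x4 W) t).
now rewrite (H _ _ D1), (H _ _ D2), (H _ _ D3), (H _ _ D4).
Qed.

Lemma Dvec_scal (c : R -> R41) (a : R) (t : R) :
  derivable_curve_at c t ->
  Dvec (fun s => scal a (c s)) t = scal a (Dvec c t).
Proof.
intros H; rewrite <- (Dvec_affine c a zero t H).
apply Dvec_ext_loc, filter_forall; intros s; symmetry.
apply (plus_zero_r (scal a (c s))).
Qed.

Lemma is_derive_mink (c d : R -> R41) (t : R) :
  derivable_curve_at c t -> derivable_curve_at d t ->
  is_derive (fun s => mink (c s) (d s)) t
    (mink (Dvec c t) (d t) + mink (c t) (Dvec d t)).
Proof.
intros [C1 [C2 [C3 C4]]] [D1 [D2 [D3 D4]]].
assert (H : forall c1 c2 c3 c4 d1 d2 d3 d4 : R -> R,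
  ex_derive c1 t -> ex_derive c2 t -> ex_derive c3 t -> ex_derive c4 t ->
  ex_derive d1 t -> ex_derive d2 t -> ex_derive d3 t -> ex_derive d4 t ->
  is_derive (fun s => c1 s * d1 s + c2 s * d2 s + c3 s * d3 s - c4 s * d4 s) t
    ((Derive c1 t * d1 t + Derive c2 t * d2 t + Derive c3 t * d3 t
        - Derive c4 t * d4 t)
     + (c1 t * Derive d1 t + c2 t * Derive d2 t + c3 t * Derive d3 t
        - c4 t * Derive d4 t))).
{ intros; auto_derive; [repeat split; assumption|eta_derive; ring]. }
exact (H _ _ _ _ _ _ _ _ C1 C2 C3 C4 D1 D2 D3 D4).
Qed.

Lemma mink_const_derivative (J : R -> Prop) (c d : R -> R41) (a v : R) :
  nondegenerate_interval J -> J v -> (forall t, J t -> mink (c t) (d t) = a) ->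
  derivable_curve_at c v -> derivable_curve_at d v ->
  mink (Dvec c v) (d v) + mink (c v) (Dvec d v) = 0.
Proof.
intros HJ Hv Ha Hc Hd.
apply (is_derive_const_on_interval J (fun s => mink (c s) (d s)) a v); auto.
now apply is_derive_mink.
Qed.

(** * Curvature of a meridian surface *)

Section Meridian.

Variables (I J : R -> Prop) (f g : R -> R) (l : R -> R41).
Hypothesis HM : timelike_meridian_II_hyperbolic I J f g l.

Let z := meridian_surface f g l.

Lemma meridian_z_u (u v : R) : I u ->
  z_u z u v = plus (scal (Derive f u) (l v)) (scal (Derive g u) e1).
Proof.
intros Hu; apply Dvec_coefficients.
- exact (smooth_on_is_derive I f u (tm_f_smooth _ _ _ _ _ HM) Hu).
- exact (smooth_on_is_derive I g u (tm_g_smooth _ _ _ _ _ HM) Hu).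
Qed.

Lemma meridian_z_v (u v : R) : J v -> z_v z u v = scal (f u) (Dvec l v).
Proof.
intros Hv.
apply (Dvec_affine l), (smooth_curve_derivable J); auto.
exact (tm_l_smooth _ _ _ _ _ HM).
Qed.

Lemma meridian_z_uu (u v : R) : I u ->
  z_uu z u v =
  plus (scal (Derive (Derive f) u) (l v)) (scal (Derive (Derive g) u) e1).
Proof.
intros Hu.
pose proof (tm_f_smooth _ _ _ _ _ HM) as Hf.
pose proof (tm_g_smooth _ _ _ _ _ HM) as Hg.
transitivity (Dvec (fun s =>
  plus (scal (Derive f s) (l v)) (scal (Derive g s) e1)) u).
- apply Dvec_ext_loc.
  generalize (filter_and _ _ (smooth_on_is_derive_near I f u Hf Hu)
                (smooth_on_is_derive_near I g u Hg Hu)).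
  apply filter_imp; intros s [Df Dg]; now apply Dvec_coefficients.
- apply Dvec_coefficients.
  + exact (smooth_on_is_derive2 I f u Hf Hu).
  + exact (smooth_on_is_derive2 I g u Hg Hu).
Qed.

Lemma meridian_z_uv (u v : R) : I u -> J v ->
  z_uv z u v = scal (Derive f u) (Dvec l v).
Proof.
intros Hu Hv.
transitivity (Dvec (fun t =>
  plus (scal (Derive f u) (l t)) (scal (Derive g u) e1)) v).
- apply Dvec_ext_loc, filter_forall; intros t; now apply meridian_z_u.
- apply Dvec_affine, (smooth_curve_derivable J); auto.
  exact (tm_l_smooth _ _ _ _ _ HM).
Qed.

Lemma meridian_z_vv (u v : R) : J v ->
  z_vv z u v = scal (f u) (Dvec (Dvec l) v).
Proof.
intros Hv.
pose proof (tm_l_smooth _ _ _ _ _ HM) as Hl.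
transitivity (Dvec (fun t => scal (f u) (Dvec l t)) v).
- apply Dvec_ext_loc.
  generalize (smooth_curve_derivable_near J l v Hl Hv).
  apply filter_imp; intros t Ht; now apply (Dvec_affine l).
- apply Dvec_scal, (smooth_curve_derivable2 J); auto.
Qed.

Lemma meridian_normalized_derivative (u : R) : I u ->
  Derive f u * Derive (Derive f) u = Derive g u * Derive (Derive g) u.
Proof.
intros Hu.
pose proof (smooth_on_is_derive2 I f u (tm_f_smooth _ _ _ _ _ HM) Hu) as Df.
pose proof (smooth_on_is_derive2 I g u (tm_g_smooth _ _ _ _ _ HM) Hu) as Dg.
assert (H : 2 * (Derive f u * Derive (Derive f) u
                 - Derive g u * Derive (Derive g) u) = 0); [|lra].
apply (is_derive_const_on_interval I
         (fun s => Derive f s ^ 2 - Derive g s ^ 2) 1 u).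
- exact (tm_I _ _ _ _ _ HM).
- exact Hu.
- exact (tm_normalized _ _ _ _ _ HM).
- set (f1 := Derive f) in *; set (g1 := Derive g) in *; clearbody f1 g1.
  auto_derive; [repeat split; eexists; eauto|].
  eta_derive; ring.
Qed.

(** By orthogonality, [z_uu] is normal and [z_uv] is tangent, so the numerator
    of the Gauss quotient reduces to [<z_uu, z_vv>]. *)
Lemma gauss_curvature_meridian (u v : R) : I u -> J v ->
  gauss_curvature z u v = Derive (Derive f) u / f u.
Proof.
intros Hu Hv.
pose proof (tm_J _ _ _ _ _ HM) as HJ.
pose proof (tm_l_smooth _ _ _ _ _ HM) as Hl.
pose proof (tm_f_pos _ _ _ _ _ HM u Hu) as Hpos.
pose proof (tm_normalized _ _ _ _ _ HM u Hu) as Hnorm.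
pose proof (meridian_normalized_derivative u Hu) as Hnorm'.
assert (L1 : forall t, J t -> derivable_curve_at l t)
  by (intros t Ht; now apply (smooth_curve_derivable J)).
assert (L2 : forall t, J t -> derivable_curve_at (Dvec l) t)
  by (intros t Ht; now apply (smooth_curve_derivable2 J)).
assert (Le : forall t, derivable_curve_at (fun _ => e1) t)
  by (intros t; repeat split; apply ex_derive_const).
assert (De : forall t, Dvec (fun _ => e1) t = zero)
  by (intros t; unfold Dvec; now rewrite !Derive_const).
assert (M0 : forall V, mink V zero = 0)
  by (intros V; unfold mink; cbn; ring).
assert (Mee : mink e1 e1 = 1) by (unfold mink; cbn; ring).
assert (Mll : forall t, J t -> mink (l t) (l t) = -1)
  by (intros t Ht; apply (tm_l_H2 _ _ _ _ _ HM t Ht)).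
assert (Ml'l' : forall t, J t -> mink (Dvec l t) (Dvec l t) = 1)
  by exact (tm_l_unit _ _ _ _ _ HM).
assert (Mle : forall t, J t -> mink (l t) e1 = 0).
{ intros t Ht; destruct (tm_l_H2 _ _ _ _ _ HM t Ht) as [E _].
  unfold mink; rewrite E; cbn; ring. }
assert (Ml'e : forall t, J t -> mink (Dvec l t) e1 = 0).
{ intros t Ht.
  pose proof (mink_const_derivative J l (fun _ => e1) 0 t HJ Ht Mle
                (L1 t Ht) (Le t)) as E.
  rewrite De, M0 in E; lra. }
assert (Ml'l : forall t, J t -> mink (Dvec l t) (l t) = 0).
{ intros t Ht.
  pose proof (mink_const_derivative J l l (-1) t HJ Ht Mll
                (L1 t Ht) (L1 t Ht)) as E.
  rewrite (mink_sym (l t)) in E; lra. }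
assert (Ml''l : mink (Dvec (Dvec l) v) (l v) = -1).
{ pose proof (mink_const_derivative J (Dvec l) l 0 v HJ Hv Ml'l
                (L2 v Hv) (L1 v Hv)) as E.
  rewrite (Ml'l' v Hv) in E; lra. }
assert (Ml''e : mink (Dvec (Dvec l) v) e1 = 0).
{ pose proof (mink_const_derivative J (Dvec l) (fun _ => e1) 0 v HJ Hv Ml'e
                (L2 v Hv) (Le v)) as E.
  rewrite De, M0 in E; lra. }
specialize (Mll v Hv); specialize (Ml'l' v Hv); specialize (Mle v Hv).
specialize (Ml'e v Hv); specialize (Ml'l v Hv).
clear L1 L2 Le De M0.
pose proof Mle as Mel; rewrite mink_sym in Mel.
pose proof Ml'e as Mel'; rewrite mink_sym in Mel'.
pose proof Ml''e as Mel''; rewrite mink_sym in Mel''.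
pose proof Ml'l as Mll'; rewrite mink_sym in Mll'.
pose proof Ml''l as Mll''; rewrite mink_sym in Mll''.
assert (HF : mink (z_u z u v) (z_v z u v) = 0).
{ rewrite meridian_z_u, meridian_z_v by assumption; mink_expand.
  rewrite Mll', Mel'; ring. }
assert (HE : mink (z_u z u v) (z_u z u v) = -1).
{ rewrite meridian_z_u by assumption; mink_expand.
  rewrite Mll, Mle, Mel, Mee; lra. }
assert (HG : mink (z_v z u v) (z_v z u v) = f u ^ 2).
{ rewrite meridian_z_v by assumption; mink_expand; rewrite Ml'l'; ring. }
assert (Huuu : mink (z_uu z u v) (z_u z u v) = 0).
{ rewrite meridian_z_uu, meridian_z_u by assumption; mink_expand.
  rewrite Mll, Mle, Mel, Mee; lra. }
assert (Huuv : mink (z_uu z u v) (z_v z u v) = 0).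
{ rewrite meridian_z_uu, meridian_z_v by assumption; mink_expand.
  rewrite Mll', Mel'; ring. }
assert (Huvu : mink (z_uv z u v) (z_u z u v) = 0).
{ rewrite meridian_z_uv, meridian_z_u by assumption; mink_expand.
  rewrite Ml'l, Ml'e; ring. }
assert (Huvv : mink (z_uv z u v) (z_v z u v) = f u * Derive f u).
{ rewrite meridian_z_uv, meridian_z_v by assumption; mink_expand.
  rewrite Ml'l'; ring. }
assert (Huvuv : mink (z_uv z u v) (z_uv z u v) = Derive f u ^ 2).
{ rewrite meridian_z_uv by assumption; mink_expand; rewrite Ml'l'; ring. }
assert (Huuvv : mink (z_uu z u v) (z_vv z u v) = - f u * Derive (Derive f) u).
{ rewrite meridian_z_uu, meridian_z_vv by assumption; mink_expand.
  rewrite Mll'', Mel''; ring. }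
pose proof (mink_sym (z_v z u v) (z_u z u v)) as HF'; rewrite HF in HF'.
unfold gauss_curvature, gauss_quotient, metric, Defs.sigma, tangent.
cbn [fst snd].
(* The products of [z_vv] with the frame drop out, being multiplied by those of
   [z_uu], which vanish. *)
rewrite !mink_normal_part
  by (rewrite ?HF, ?HE, ?HG; auto; try lra; apply pow_nonzero; lra).
mink_expand; rewrite HE, HF, HG, HF', Huuu, Huuv, Huvu, Huvv, Huvuv, Huuvv.
field; lra.
Qed.

Lemma constant_curvature_iff_ode (K : R) :
  (forall u v, I u -> J v -> gauss_curvature z u v = K) <->
  (forall u, I u -> Derive (Derive f) u = K * f u).
Proof.
split.
- intros HK u Hu.
  destruct (tm_J _ _ _ _ _ HM) as [_ [v [_ [Hv _]]]].
  pose proof (tm_f_pos _ _ _ _ _ HM u Hu).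
  rewrite <- (HK u v Hu Hv), (gauss_curvature_meridian u v Hu Hv).
  field; lra.
- intros Hode u v Hu Hv.
  pose proof (tm_f_pos _ _ _ _ _ HM u Hu).
  rewrite (gauss_curvature_meridian u v Hu Hv), (Hode u Hu); field; lra.
Qed.

(** At a zero of [g'] one would have [f'^2 = 1] and [f' f'' = 0], hence
    [K f = f'' = 0]. *)
Lemma meridian_derive_g_nonzero (K : R) :
  K <> 0 -> (forall u, I u -> Derive (Derive f) u = K * f u) ->
  forall u, I u -> Derive g u <> 0.
Proof.
intros HK Hode u Hu H0.
pose proof (tm_f_pos _ _ _ _ _ HM u Hu) as Hpos.
pose proof (tm_normalized _ _ _ _ _ HM u Hu) as Hnorm.
pose proof (meridian_normalized_derivative u Hu) as H1.
rewrite H0, (Hode u Hu), Rmult_0_l in H1; rewrite H0 in Hnorm.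
destruct (Rmult_integral _ _ H1) as [E|E].
- rewrite E in Hnorm; lra.
- destruct (Rmult_integral _ _ E); lra.
Qed.

Lemma meridian_g_sign (K : R) :
  K <> 0 -> (forall u, I u -> Derive (Derive f) u = K * f u) ->
  exists eps : R, (eps = 1 \/ eps = -1) /\
    forall u, I u -> Derive g u = eps * sqrt ((Derive f u) ^ 2 - 1).
Proof.
intros HK Hode.
destruct (continuous_sign_on_interval I (Derive g)) as [eps [He Hg]].
- exact (tm_I _ _ _ _ _ HM).
- intros u Hu; apply (ex_derive_continuous (Derive g)); eexists.
  exact (smooth_on_is_derive2 I g u (tm_g_smooth _ _ _ _ _ HM) Hu).
- exact (meridian_derive_g_nonzero K HK Hode).
- exists eps; split; [exact He|]; intros u Hu.
  pose proof (tm_normalized _ _ _ _ _ HM u Hu) as Hnorm.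
  replace ((Derive f u) ^ 2 - 1) with (Rsqr (Derive g u))
    by (unfold Rsqr; lra).
  rewrite sqrt_Rsqr_abs; exact (Hg u Hu).
Qed.

End Meridian.

(** * Meridian surfaces of constant curvature *)

Theorem theorem5p4 (I J : R -> Prop) (f g : R -> R) (l : R -> R41) (K : R)
  (HM : timelike_meridian_II_hyperbolic I J f g l) :
  (K <> 0 /\
   forall u v, I u -> J v -> gauss_curvature (meridian_surface f g l) u v = K)
  <->
  (((K < 0 /\ exists a1 a2 : R, forall u, I u ->
       f u = a1 * cos (sqrt (- K) * u) + a2 * sin (sqrt (- K) * u)) \/
    (0 < K /\ exists a1 a2 : R, forall u, I u ->
       f u = a1 * cosh (sqrt K * u) + a2 * sinh (sqrt K * u))) /\
   exists eps : R, (eps = 1 \/ eps = -1) /\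
     forall u, I u -> Derive g u = eps * sqrt ((Derive f u) ^ 2 - 1)).
Proof.
pose proof (tm_I _ _ _ _ _ HM) as HI.
pose proof (tm_f_smooth _ _ _ _ _ HM) as Hf.
rewrite (constant_curvature_iff_ode I J f g l HM K).
split.
- intros [HK Hode]; split.
  + destruct (Rtotal_order K 0) as [L|[E|L]].
    * left; split; [exact L|now apply trigonometric_solutions].
    * contradiction.
    * right; split; [exact L|now apply hyperbolic_solutions].
  + exact (meridian_g_sign I J f g l HM K HK Hode).
- intros [[[L Hsol]|[L Hsol]] _]; (split; [lra|]).
  + now apply (trigonometric_solutions I f K HI Hf L).
  + now apply (hyperbolic_solutions I f K HI Hf L).
Qed.
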